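(* Let $n\ge2$, $1\le p\le n-1$, and $1\le r\le n-p$. Let $\pi\in S_n$ be a $p$-resultant permutation such that $r$ is a left-to-right maximum of $(\pi_1,\dots,\pi_{n-p})$. Suppose the left-to-right maxima of $(\pi_1,\dots,\pi_{n-p})$ are, in increasing order, $i_1<\dots<i_a<r<j_1<\dots<j_b$ (with $a,b\ge0$), and that $(\pi_{n-p+1},\dots,\pi_n)$ has $k$ right-to-left minima. Let $N_\pi$ be the number of $\sigma\in S_{n-1}$ such that $\sigma^{(r,p)}$ topples to $\pi$. Then $N_\pi=\Delta^a\big(B_{b,k}\big)=\sum_{t=0}^{a}(-1)^{a-t}\binom{a}{t}B_{b+t,k}$, with $\Delta$ acting on the first index.
   Context: For $m\ge1$, $1\le p\le m$: sites are $0,\dots,m+1$; a configuration in $\mathcal{S}(m,p)$ places $m+1$ distinct chips labeled $1,\dots,m+1$ with sites $0,m+1$ empty, one chip at each site of $\{1,\dots,m\}\setminus\{p\}$ and two chips at site $p$. Toppling: while some site holds at least two chips, choose such a site $i$ and two chips $\alpha<\beta$ there and move $\alpha$ to $i-1$, $\beta$ to $i+1$. It is known this terminates with at most one chip per site and the final configuration is independent of the choices; reading labels left to right gives a permutation in $S_{m+1}$ to which the configuration topples. For $\sigma\in S_m$, $r\in[m+1]$, $\sigma^{(r,p)}$ places at site $i$ ($1\le i\le m$) chip $\sigma_i$ if $\sigma_i<r$ and $\sigma_i+1$ otherwise, plus chip $r$ at site $p$. $\pi\in S_n$ is $p$-resultant if some configuration in $\mathcal{S}(n-1,p)$ topples to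 it. Left-to-right maximum of $a_1\cdots a_k$: an entry $a_j=\max\{a_1,\dots,a_j\}$; right-to-left minimum: an entry $a_j=\min\{a_j,\dots,a_k\}$. Forward difference $\Delta f(m)=f(m+1)-f(m)$. Poly-Bernoulli numbers of type B: $\sum_{n\ge0}B_{n,k}\frac{x^n}{n!}=\frac{\mathrm{Li}_{-k}(1-e^{-x})}{1-e^{-x}}$, $\mathrm{Li}_s(z)=\sum_{i\ge1}z^i/i^s$; equivalently $B_{n,k}=\sum_{m=0}^{\min(n,k)}(m!)^2\left\{{n+1\atop m+1}\right\}\left\{{k+1\atop m+1}\right\}$. *)

(* Defs.v *)
From mathcomp Require Import all_boot all_order all_algebra.
Set Implicit Arguments. Unset Strict Implicit. Unset Printing Implicit Defensive.
Import Order.TTheory GRing.Theory Num.Theory.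

(* ---------- Chip-firing configurations ----------
   A configuration with N chips labelled 1..N is a function
   [c : nat -> int] giving the site of each chip (values on labels
   outside 1..N are irrelevant).  Sites are integers. *)
Definition config := nat -> int.

Definition topple_step (N : nat) (c c' : config) : Prop :=
  exists (i : int) (alpha beta : nat),
    [/\ (1 <= alpha < beta)%N, (beta <= N)%N,
        c alpha = i, c beta = i &
        c' = (fun x => if x == alpha then (i - 1)%R
                       else if x == beta then (i + 1)%R else c x)].

Inductive topples_star (N : nat) : config -> config -> Prop :=
| ts_refl c : topples_star N c c
| ts_step c c' c'' : topple_step N c c' -> topples_star N c' c'' ->
                     topples_star N c c''.

(* A configuration c reads (left to right) as the word pi: pi lists each chip
   1..N exactly once, in strictly increasing order of position (in particular
   at most one chip per site, i.e. c is stable). *)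
Definition reads_as (N : nat) (c : config) (pi : seq nat) : Prop :=
  perm_eq pi (iota 1 N) /\ sorted (fun x y => (c x < c y)%R) pi.

Definition topples_to (N : nat) (c : config) (pi : seq nat) : Prop :=
  exists c', topples_star N c c' /\ reads_as N c' pi.

Definition nchips (m : nat) (c : config) (i : int) : nat :=
  count (fun x => c x == i) (iota 1 m.+1).

Definition in_S (m p : nat) (c : config) : Prop :=
  forall i : int,
    nchips m c i = (if i == p%:Z%R then 2
                    else if ((1 <= i)%R && (i <= m%:Z%R)%R) then 1 else 0)%N.

Definition p_resultant (n p : nat) (pi : seq nat) : Prop :=
  exists c, in_S n.-1 p c /\ topples_to n c pi.

(* sigma^(r,p) for sigma in S_m given as the word sigma_1 ... sigma_m:
   chip r at site p; at site i (1<=i<=m) the chip sigma_i if sigma_i < r,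
   and sigma_i + 1 otherwise.  Hence chip x <> r sits at the site
   (1 + index of x' in sigma) where x' = x if x < r and x' = x - 1 otherwise. *)
Definition sigma_rp (sigma : seq nat) (r p : nat) : config :=
  fun x => if x == r then p%:Z%R
           else ((index (if (x < r)%N then x else x.-1) sigma).+1)%:Z%R.

Definition is_lrmax (s : seq nat) (j : nat) : bool :=
  all (fun i => nth 0 s i <= nth 0 s j)%N (iota 0 j.+1).
Definition lrmaxima (s : seq nat) : seq nat :=
  [seq nth 0 s j | j <- iota 0 (size s) & is_lrmax s j].

Definition is_rlmin (s : seq nat) (j : nat) : bool :=
  all (fun i => nth 0 s j <= nth 0 s i)%N (iota j (size s - j)).
Definition rlminima (s : seq nat) : seq nat :=
  [seq nth 0 s j | j <- iota 0 (size s) & is_rlmin s j].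

Fixpoint stirling2 (n k : nat) : nat :=
  match n, k with
  | 0, 0 => 1
  | 0, _.+1 => 0
  | _.+1, 0 => 0
  | n'.+1, k'.+1 => k'.+1 * stirling2 n' k'.+1 + stirling2 n' k'
  end.

Definition polyB (n k : nat) : nat :=
  \sum_(m < (minn n k).+1) (m`! ^ 2 * stirling2 n.+1 m.+1 * stirling2 k.+1 m.+1).

Definition fdiff (f : nat -> int) : nat -> int := fun m => (f m.+1 - f m)%R.

(* Main.v *)
Require Import Defs.
From mathcomp Require Import all_boot all_order all_algebra.
From mathcomp Require Import ring zify.
Import Order.TTheory GRing.Theory Num.Theory.

(** The firings form a grid with [p] rows and [q = n - p] columns: the chips of
    the sites [p], [p - 1], ..., [1] are successively dragged, by a pass of bubble
    sort, through the word [v] that initially reads [r], then the chips of the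
    sites [p + 1], ..., [n - 1].  Each pass ejects its maximum, the ejected chips
    end up as the last [p] letters of [pi] and the final [v] as its first [q].

    Preimages are counted by undoing the passes one at a time.  A pass with output
    [v] and ejected chip [h > max v] has one preimage which leaves [v] unchanged;
    the others have as left-to-right maxima [h] together with the elements of a
    proper subset of those of [v], each subset occurring once.  If a smaller chip
    remains to be inserted back, only the first preimage can be continued, so
    every chip that is not a right-to-left minimum acts trivially.  As [r] must
    survive and finally be the least left-to-right maximum, the number [G k a b] of
    preimages satisfies [G 0 a b = (a == 0)] and
      [G (k+1) a b = G k a b - G k a (b+1) + sum_(s, t) C(a, s) C(b, t) G k s (t+1)],
    a recursion which the differences of the poly-Bernoulli numbers also obey. *)

(** * Binomial transforms and iterated forward differences *)

Definition binsum (a : nat) (f : nat -> int) : int :=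
  (\sum_(s < a.+1) Posz 'C(a, s) * f s)%R.

Lemma binsum0 f : binsum 0 f = f 0.
Proof. by rewrite /binsum big_ord1 bin0 mul1r. Qed.

Lemma binsumS a f :
  binsum a.+1 f = (binsum a f + binsum a (fun s => f s.+1))%R.
Proof.
rewrite /binsum big_ord_recl bin0.
under eq_bigr => i _ do rewrite /bump /= ?add1n binS PoszD mulrDl.
rewrite big_split /= addrA; congr (_ + _)%R.
rewrite [in RHS]big_ord_recl bin0 big_ord_recr /= bin_small // mul0r addr0.
by [].
Qed.

Lemma eq_binsum a f g : f =1 g -> binsum a f = binsum a g.
Proof. by move=> fg; apply: eq_bigr => i _; rewrite fg. Qed.

Lemma binsumD a f g :
  binsum a (fun s => f s + g s)%R = (binsum a f + binsum a g)%R.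
Proof. by rewrite -big_split /=; apply: eq_bigr => i _; rewrite mulrDr. Qed.

Lemma binsumZ a c f : binsum a (fun s => c * f s)%R = (c * binsum a f)%R.
Proof. by rewrite mulr_sumr; apply: eq_bigr => i _; rewrite mulrCA. Qed.

Lemma eq_iter_fdiff a f g : f =1 g -> iter a fdiff f =1 iter a fdiff g.
Proof. by move=> fg; elim: a => //= a IH x; rewrite /fdiff !IH. Qed.

Lemma iter_fdiff_sum a f b :
  iter a fdiff f b =
  (\sum_(t < a.+1) (-1) ^+ (a - t) * Posz 'C(a, t) * f (b + t)%N)%R.
Proof.
elim: a f b => [|a IH] f b; first by rewrite big_ord1 bin0 subnn expr0 !mul1r /= addn0.
rewrite iterS /fdiff !IH [in RHS]big_ord_recl subn0 bin0.
under [in RHS]eq_bigr => i _.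
  rewrite /bump /= ?add1n subSS binS PoszD addnS -addSn mulrDr mulrDl.
  over.
rewrite big_split /= addrA [LHS]addrC; congr (_ + _)%R.
rewrite [in RHS]big_ord_recr /= bin_small // mulr0 mul0r addr0.
rewrite big_ord_recl subn0 bin0 opprD -sumrN; congr (_ + _)%R.
  by rewrite exprS; ring.
apply: eq_bigr => i _; rewrite /bump /= ?add1n addSnnS.
by rewrite -(subnSK (ltn_ord i)) exprS; ring.
Qed.

(** Newton's formula: the shift is the identity plus the difference operator, and its [a]-th power
    is expanded. *)
Lemma binsum_iter_fdiff a f b : binsum a (fun s => iter s fdiff f b) = f (b + a).
Proof.
elim: a b => [|a IH] b; first by rewrite binsum0 addn0.
rewrite binsumS IH (eq_binsum _ _ (fun s => iter s fdiff f b.+1 + (-1) * iter s fdiff f b)%R).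
  by rewrite binsumD binsumZ !IH addSnnS; ring.
by move=> s; rewrite iterS /fdiff; ring.
Qed.

(** By Pascal's rule, differencing a binomial transform shifts the transformed sequence. *)
Lemma iter_fdiff_binsum a f b :
  iter a fdiff (fun b => binsum b (fun t => f t)) b = binsum b (fun t => f (t + a)).
Proof.
elim: a b => [|a IH] b; first by apply: eq_binsum => t; rewrite addn0.
rewrite iterS /fdiff !IH binsumS addrAC subrr add0r.
by apply: eq_binsum => t; rewrite addnS.
Qed.

Lemma iter_fdiffD a f g b :
  iter a fdiff (fun b => f b + g b)%R b = (iter a fdiff f b + iter a fdiff g b)%R.
Proof. by elim: a b => //= a IH b; rewrite /fdiff !IH; ring. Qed.

Lemma iter_fdiffB a f g b :
  iter a fdiff (fun b => f b - g b)%R b = (iter a fdiff f b - iter a fdiff g b)%R.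
Proof. by elim: a b => //= a IH b; rewrite /fdiff !IH; ring. Qed.

Lemma iter_fdiff_shift a f b : iter a fdiff (fun b => f b.+1) b = iter a fdiff f b.+1.
Proof. by elim: a b => //= a IH b; rewrite /fdiff !IH. Qed.

(** * Stirling numbers and the recursion of the poly-Bernoulli numbers in their second index *)

Lemma stirling2SS n k :
  stirling2 n.+1 k.+1 = k.+1 * stirling2 n k.+1 + stirling2 n k.
Proof. by []. Qed.

Lemma stirling2_small n k : n < k -> stirling2 n k = 0.
Proof.
by elim: n k => [|n IH] [|k] //= nk; rewrite !IH ?muln0 // ltnW.
Qed.

(** Both sides count the partitions of [b + 2] elements into [m + 1] blocks that separate two marked
    elements: choose the [t] unmarked elements outside the block of the first one, then partition
    them together with the second. *)
Lemma binsum_stirling2S b m :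
  binsum b (fun t => Posz (stirling2 t.+1 m)) =
  (Posz (stirling2 b.+2 m.+1) - Posz (stirling2 b.+1 m.+1))%R.
Proof.
elim: b m => [|b IH] m.
  rewrite binsum0; case: m => [|[|m]] //=; by rewrite !muln0.
rewrite binsumS IH.
case: m => [|m].
  rewrite [X in (_ + X)%R]big1 //=; first by lia.
  by move=> i _; rewrite /= mulr0.
have -> : binsum b (fun s => Posz (stirling2 s.+2 m.+1)) =
  (Posz m.+1 * binsum b (fun s => Posz (stirling2 s.+1 m.+1)) +
   binsum b (fun s => Posz (stirling2 s.+1 m)))%R.
  by rewrite -binsumZ -binsumD; apply: eq_binsum => s; rewrite /= PoszD PoszM.
rewrite !IH.
rewrite (stirling2SS b.+2); have := stirling2SS b.+1 m.+1.
move: (stirling2 b.+2 _) (stirling2 b.+1 _) (stirling2 b.+2 _) (stirling2 b.+1 _).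
move=> x y z t ->; lia.
Qed.

Lemma binsum_stirling2SS b m :
  binsum b (fun t => Posz (stirling2 t.+2 m.+1)) =
  (Posz (m.+1 ^ 2) * Posz (stirling2 b.+1 m.+2)
   + Posz m.*2.+1 * Posz (stirling2 b.+1 m.+1) + Posz (stirling2 b.+1 m))%R.
Proof.
rewrite (eq_binsum _ _ (fun t => Posz m.+1 * Posz (stirling2 t.+1 m.+1)
                                 + Posz (stirling2 t.+1 m))%R); last first.
  by move=> t; rewrite stirling2SS PoszD PoszM.
rewrite binsumD binsumZ !binsum_stirling2S !(stirling2SS b.+1).
by move: (stirling2 b.+1 _) (stirling2 b.+1 _) (stirling2 b.+1 _) => x y z; nia.
Qed.

(** Half of a summand of [polyB]: the squared factorial is shared evenly between the two Stirling
    numbers. *)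
Definition fact_stirling (m b : nat) : int := Posz (m`! * stirling2 b.+1 m.+1).

Lemma fact_stirlingS m b :
  fact_stirling m b.+1 =
  (Posz m.+1 * fact_stirling m b + Posz m * fact_stirling m.-1 b)%R.
Proof.
rewrite /fact_stirling stirling2SS; case: m => [|m]; first by rewrite /= fact0; lia.
rewrite -[m.+1.-1]/m factS.
by move: (stirling2 b.+1 _) (stirling2 b.+1 _) => x y; nia.
Qed.

(** The right side is the transpose, with respect to [m], of the rule [fact_stirlingS]; summing over
    [m] thus trades a step in [k] for an operator acting on [b]. *)
Lemma fact_stirling_binsum m b :
  (fact_stirling m b - fact_stirling m b.+1
   + binsum b (fun t => fact_stirling m t.+1))%R =
  (Posz m.+1 * (fact_stirling m b + fact_stirling m.+1 b))%R.
Proof.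
rewrite (eq_binsum _ _ (fun t => Posz m`! * Posz (stirling2 t.+2 m.+1))%R); last first.
  by move=> t; rewrite -PoszM.
rewrite binsumZ binsum_stirling2SS /fact_stirling factS (stirling2SS b.+1).
move: (stirling2 b.+1 m.+2) (stirling2 b.+1 m.+1) (stirling2 b.+1 m) => x y z.
rewrite -muln2 -mulnn !PoszM !PoszD !PoszM; ring.
Qed.

Lemma polyB_sum M n k : n < M ->
  Posz (polyB n k) = (\sum_(m < M) fact_stirling m n * fact_stirling m k)%R.
Proof.
move=> nM; have minM : (minn n k).+1 <= M by lia.
rewrite -(big_mkord xpredT (fun m => fact_stirling m n * fact_stirling m k)%R).
rewrite (big_cat_nat (leq0n _) minM) /= [X in (_ + X)%R]big1_seq ?addr0; last first.
  move=> m; rewrite mem_index_iota => /andP[_ /andP[mm _]]; rewrite /fact_stirling.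
  have [nk|kn] := leqP n k.
    by rewrite [stirling2 n.+1 _]stirling2_small ?muln0 ?mul0r //; lia.
  by rewrite [stirling2 k.+1 _]stirling2_small ?muln0 ?mulr0 //; lia.
rewrite big_mkord /polyB (big_morph Posz PoszD (erefl _)).
apply: eq_bigr => m _; rewrite /fact_stirling -PoszM -mulnn; congr Posz; lia.
Qed.

Lemma polyB0 n : polyB n 0 = 1.
Proof.
rewrite /polyB minn0 big_ord1 /=; elim: n => [|n IH] //=.
by move: IH; rewrite /= !mul1n !addn0 muln1 => ->.
Qed.

Lemma polyB_rec b k :
  Posz (polyB b k.+1) =
  (Posz (polyB b k) - Posz (polyB b.+1 k)
   + binsum b (fun t => Posz (polyB t.+1 k)))%R.
Proof.
(* Large enough for all the indices [b], [b + 1], [t + 1] in use, and for [fact_stirling M k] to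
   vanish. *)
pose M := (b + k).+2.
rewrite (@polyB_sum M.+1 b) 1?(@polyB_sum M.+1 b k) 1?(@polyB_sum M.+1 b.+1 k); try lia.
have -> : binsum b (fun t => Posz (polyB t.+1 k)) =
    (\sum_(m < M.+1) binsum b (fun t => fact_stirling m t.+1) * fact_stirling m k)%R.
  transitivity (\sum_(t < b.+1) \sum_(m < M.+1)
     Posz 'C(b, t) * (fact_stirling m t.+1 * fact_stirling m k))%R.
    apply: eq_bigr => t _; rewrite (@polyB_sum M.+1) ?mulr_sumr //.
    by have := ltn_ord t; lia.
  rewrite exchange_big; apply: eq_bigr => m _ /=; rewrite /binsum mulr_suml.
  by apply: eq_bigr => t _; rewrite mulrA.
rewrite -sumrB -big_split /=.
under [RHS]eq_bigr => m _ do rewrite -mulrBl -mulrDl fact_stirling_binsum mulrDr mulrDl.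
rewrite [RHS]big_split /=.
under [LHS]eq_bigr => m _ do rewrite fact_stirlingS mulrDr.
rewrite big_split /=; congr (_ + _)%R.
  by apply: eq_bigr => m _; ring.
(* Shifting [m] by one loses only the term [m = 0] on the left, whose coefficient is 0, and the term
   [m = M] on the right, which vanishes as [k < M]. *)
rewrite [LHS]big_ord_recl [RHS]big_ord_recr /= mul0r mulr0 add0r.
rewrite [fact_stirling M k]/fact_stirling stirling2_small ?muln0 ?mulr0 ?addr0; last by lia.
by apply: eq_bigr => m _; rewrite /bump /=; ring.
Qed.

(** Differencing [polyB_rec] [a] times shifts the binomial sum over [t] by [a], and Newton's formula
    opens this shift into a sum over [s]. *)
Lemma iter_fdiff_polyB_rec a b k :
  let G k a b := iter a fdiff (fun m => Posz (polyB m k)) b in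
  G k.+1 a b = (G k a b - G k a b.+1
    + binsum a (fun s => binsum b (fun t => G k s t.+1)))%R.
Proof.
move=> G; rewrite /G.
rewrite (@eq_iter_fdiff a _ _ (fun m => polyB_rec m k)) iter_fdiffD iter_fdiffB.
rewrite (iter_fdiff_shift a (fun m => Posz (polyB m k))); congr (_ + _)%R.
rewrite (iter_fdiff_binsum a (fun t => Posz (polyB t.+1 k))).
transitivity (binsum b (fun t => binsum a
   (fun s => iter s fdiff (fun m => Posz (polyB m k)) t.+1))).
  by apply: eq_binsum => t; rewrite binsum_iter_fdiff addSn.
rewrite /binsum; under eq_bigr => i _ do rewrite mulr_sumr.
rewrite exchange_big /=; apply: eq_bigr => i _; rewrite mulr_sumr.
by apply: eq_bigr => j _; rewrite mulrCA.
Qed.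

Lemma iter_fdiff_polyB0 a b :
  iter a fdiff (fun m => Posz (polyB m 0)) b = Posz (a == 0).
Proof.
rewrite (@eq_iter_fdiff a _ (fun=> 1%R)) => [|m]; last by rewrite polyB0.
case: a => // a; elim: a b => [|a IH] b; first by rewrite /= /fdiff subrr.
by rewrite iterS {1}/fdiff !IH subrr.
Qed.

(** * One pass of bubble sort and its preimages *)

(* Words are stored reversed: [x] enters at the last entry of [u], and the maximum
   leaves at the head. *)
Fixpoint bubble (x : nat) (u : seq nat) : nat * seq nat :=
  if u is y :: u' then
    let: (m, w) := bubble x u' in (maxn m y, minn m y :: w)
  else (x, [::]).

(** The pass seen from the end where [x] enters: its first comparison is a single firing. *)
Lemma bubble_rcons x y u :
  bubble x (rcons u y) =
  ((bubble (maxn x y) u).1, rcons (bubble (maxn x y) u).2 (minn x y)).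
Proof.
elim: u => [|z u IH] //=; rewrite IH /=.
by case: (bubble (maxn x y) u).
Qed.

Lemma perm_bubble x u : perm_eq ((bubble x u).1 :: (bubble x u).2) (x :: u).
Proof.
elim: u => [|y u IH] //=; case: (bubble x u) IH => m w /= IH.
have -> : x :: y :: u = [:: x] ++ y :: u by [].
rewrite perm_sym perm_catC /= -(cat1s y) perm_sym.
apply: (@perm_trans _ (y :: m :: w)); last first.
  by rewrite perm_cons perm_sym perm_catC perm_sym.
rewrite /maxn /minn; case: ifP => _ //.
by rewrite -(cat1s m) -(cat1s y) perm_catCA.
Qed.

Lemma bubble_lt x u n :
  all (fun y => y < n) u -> all (fun y => y < n) (bubble x u).2.
Proof.
elim: u => [|y u IH] //= /andP[yn /IH]; case: (bubble x u) => m w /= ->.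
by rewrite andbT gtn_min yn orbT.
Qed.

Lemma bubble_max h u :
  all (fun y => y < h) u -> bubble h u = (h, u).
Proof.
elim: u => [|y u IH] //= /andP[yh /IH ->].
by rewrite (maxn_idPl (ltnW yh)) (minn_idPr (ltnW yh)).
Qed.

(* The preimages [(x, w)] of [(h, u)] under [bubble], other than the trivial one
   [(h, u)], when [h] exceeds every entry of [u] (otherwise there is none). *)
Fixpoint unbubbles (u : seq nat) (h : nat) : seq (nat * seq nat) :=
  if u is v :: u' then
    [seq (t.1, v :: t.2) | t <- unbubbles u' h] ++
    (if all (fun y => y < v) u'
     then [seq (t.1, h :: t.2) | t <- (v, u') :: unbubbles u' v] else [::])
  else [::].

Definition preimages (u : seq nat) (h : nat) : seq (nat * seq nat) :=
  if all (fun y => y < h) u then (h, u) :: unbubbles u h else [::].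

(** Before the pass the head was either [v], with [h] coming out of the rest, or [h], with [v]
    coming out of the rest. *)
Lemma unbubbles_cons v u h :
  unbubbles (v :: u) h =
  [seq (t.1, v :: t.2) | t <- unbubbles u h] ++
  [seq (t.1, h :: t.2) | t <- preimages u v].
Proof. by rewrite /preimages /=; case: ifP. Qed.

(** In a nontrivial preimage the ejected chip already stood in the word; if [h] is not in [u], this
    sets it apart from the trivial one. *)
Lemma unbubbles_mem u h t : t \in unbubbles u h -> h \in t.2.
Proof.
elim: u h t => [|v u IH] h t //; rewrite unbubbles_cons mem_cat => /orP[].
  by move=> /mapP[s /IH hs ->]; rewrite inE hs orbT.
by move=> /mapP[s _ ->]; rewrite inE eqxx.
Qed.

Lemma mem_preimages u h t :
  (t \in preimages u h) =
  all (fun y => y < h) u && ((t == (h, u)) || (t \in unbubbles u h)).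
Proof. by rewrite /preimages; case: ifP. Qed.

Lemma perm_unbubbles u h t :
  t \in unbubbles u h -> perm_eq (t.1 :: t.2) (h :: u).
Proof.
have swap (a b : nat) s : perm_eq (a :: b :: s) (b :: a :: s).
  by rewrite -(cat1s a) -(cat1s b) perm_catCA.
elim: u h t => [|v u IH] h t //; rewrite unbubbles_cons mem_cat => /orP[].
  move=> /mapP[s /IH hs ->] /=; apply: perm_trans (swap _ _ _) _.
  by rewrite perm_sym; apply: perm_trans (swap _ _ _) _; rewrite perm_cons perm_sym.
move=> /mapP[s]; rewrite mem_preimages => /andP[_ /predU1P[-> ->|/IH hs ->]] /=.
  exact: swap.
by apply: perm_trans (swap _ _ _) _; rewrite perm_cons.
Qed.

Lemma perm_preimages u h t :
  t \in preimages u h -> perm_eq (t.1 :: t.2) (h :: u).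
Proof. by rewrite mem_preimages => /andP[_ /predU1P[->|/perm_unbubbles]]. Qed.

Lemma bubble_preimages x w u h :
  (x, w) \in preimages u h -> bubble x w = (h, u).
Proof.
elim: u h x w => [|v u IH] h x w; rewrite mem_preimages => /andP[uh] /predU1P[[-> ->]|] //;
  try exact: bubble_max.
move: uh => /= /andP[vh uh].
rewrite -/(unbubbles (v :: u) h) unbubbles_cons mem_cat => /orP[] /mapP[[y s] ys [-> ->]] /=.
  by rewrite (IH h) ?mem_preimages ?uh ?ys ?orbT // (maxn_idPl (ltnW vh)) (minn_idPr (ltnW vh)).
by rewrite (IH _ _ _ ys) (maxn_idPr (ltnW vh)) (minn_idPl (ltnW vh)).
Qed.

(** Completeness compares the head [y] with the chip [m] that the rest ejects: distinct labels rule
    out a tie, and the larger of the two tells which case of [unbubbles_cons] applies. *)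
Lemma preimagesP x u h w : uniq (x :: w) ->
  ((x, w) \in preimages u h) = (bubble x w == (h, u)).
Proof.
move=> uniq_xw; apply/idP/eqP; first exact: bubble_preimages.
elim: w u h uniq_xw => [|y w IH] u h uniq_xyw /=; first by case=> <- <-; rewrite inE.
have uniq_xw : uniq (x :: w).
  by move: uniq_xyw => /= /andP[]; rewrite inE negb_or => /andP[_ ->] /andP[].
have := perm_bubble x w.
case E : (bubble x w) => [m w'] /= mw [<- <-].
have mem := IH _ _ uniq_xw E; rewrite mem_preimages unbubbles_cons mem_cat.
have w'm : all (fun z => z < m) w' by move: mem; rewrite mem_preimages => /andP[].
have : m != y.
  apply: contraTneq uniq_xyw => my; rewrite -my /=.
  have : m \in x :: w by rewrite -(perm_mem mw) mem_head.
  by rewrite !inE [m == x]eq_sym => /orP[->|->] //; rewrite andbF.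
rewrite neq_ltn => /orP[my|ym].
  rewrite (maxn_idPr (ltnW my)) (minn_idPl (ltnW my)) /= my.
  have -> /= : all (fun z => z < y) w'.
    by apply: sub_all w'm => z zm; apply: ltn_trans my.
  by apply/orP; right; apply/orP; right; apply/mapP; exists (x, w).
rewrite (maxn_idPl (ltnW ym)) (minn_idPr (ltnW ym)) /= ym w'm /=.
move: mem; rewrite mem_preimages w'm /= => /predU1P[[-> ->]|mem]; first by rewrite eqxx.
by apply/orP; right; apply/orP; left; apply/mapP; exists (x, w).
Qed.

Lemma uniq_unbubbles u h : h \notin u -> uniq u -> uniq (unbubbles u h).
Proof.
elim: u h => [|v u IH] h //; rewrite inE negb_or => /andP[hv hu] /andP[vu uu].
have inj (z : nat) : injective (fun t : nat * seq nat => (t.1, z :: t.2)).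
  by move=> [? ?] [? ?] /= [-> ->].
rewrite unbubbles_cons cat_uniq !(map_inj_uniq (inj _)) IH //=; apply/andP; split.
  apply/hasPn => t /mapP[s _ ->]; apply/mapP => -[s' _ [_ /eqP]].
  by rewrite (negPf hv).
rewrite /preimages; case: ifP => //= _; rewrite IH // andbT.
by apply/negP => /unbubbles_mem /=; rewrite (negPf vu).
Qed.

Lemma uniq_preimages u h : h \notin u -> uniq u -> uniq (preimages u h).
Proof.
move=> hu uu; rewrite /preimages; case: ifP => //= _.
by rewrite uniq_unbubbles // andbT; apply/negP => /unbubbles_mem; rewrite (negPf hu).
Qed.

(** * Left-to-right maxima when a pass is undone *)

(** As words are stored reversed, these are the left-to-right maxima of the actual word, largest
    first. *)
Fixpoint lrm (u : seq nat) : seq nat :=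
  if u is v :: u' then
    if all (fun y => y < v) u' then v :: lrm u' else lrm u'
  else [::].

Fixpoint sublists (l : seq nat) : seq (seq nat) :=
  if l is x :: l' then sublists l' ++ [seq x :: s | s <- sublists l']
  else [:: [::]].

(** The added term stands for the full subset, which no nontrivial preimage yields. The weight [F]
    is arbitrary because the induction also uses it with [h] prefixed to its argument. *)
Lemma sum_unbubbles u h (F : seq nat -> int) :
  all (fun y => y < h) u ->
  (\sum_(t <- unbubbles u h) F (lrm t.2) + F (h :: lrm u))%R =
  (\sum_(s <- sublists (lrm u)) F (h :: s))%R.
Proof.
elim: u h F => [|v u IH] h F; first by rewrite /= big_nil big_seq1 add0r.
move=> /= /andP[vh uh]; rewrite -/(unbubbles (v :: u) h) unbubbles_cons big_cat /= !big_map.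
(* The larger [h] behind [v] prevents [v] from being a maximum. *)
have -> : (\sum_(t <- unbubbles u h) F (lrm (v :: t.2)) =
           \sum_(t <- unbubbles u h) F (lrm t.2))%R.
  apply: eq_big_seq => t /unbubbles_mem ht /=; case: allP => // /(_ h ht).
  by rewrite ltnNge (ltnW vh).
rewrite /preimages; case: ifP => uv; last by rewrite big_nil addr0 IH.
rewrite big_cons /= uh big_cat big_map /=.
rewrite -(IH h) // -[X in _ = (_ + X)%R](IH v (fun l => F (h :: l))) //.
(* These words consist of entries below [h], so [h] at the head is a maximum. *)
have -> : (\sum_(t <- unbubbles u v) F (if all (fun y => (y < h)%N) t.2
            then h :: lrm t.2 else lrm t.2) =
           \sum_(t <- unbubbles u v) F (h :: lrm t.2))%R.
  apply: eq_big_seq => t /perm_unbubbles tp.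
  have : all (fun y => y < h) (t.1 :: t.2) by rewrite (perm_all _ tp) /= vh.
  by move=> /= /andP[_ ->].
ring.
Qed.

Lemma sum_sublists r l (F : nat -> nat -> nat -> int) :
  (\sum_(s <- sublists l) F (count (fun x => x < r)%N s)
     (count (fun x => x == r) s) (count (fun x => r < x)%N s))%R =
  binsum (count (fun x => x < r) l) (fun i =>
    binsum (count (fun x => x == r) l) (fun j =>
      binsum (count (fun x => r < x) l) (fun k => F i j k))).
Proof.
elim: l F => [|x l IH] F; first by rewrite /= big_seq1 !binsum0.
rewrite /= big_cat big_map /=.
case: (ltngtP x r) => xr; rewrite /= ?add0n ?add1n.
- by rewrite binsumS IH (IH (fun i j k => F i.+1 j k)).
- rewrite IH (IH (fun i j k => F i j k.+1)) -binsumD; apply: eq_binsum => i.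
  by rewrite -binsumD; apply: eq_binsum => j; rewrite binsumS.
- rewrite IH (IH (fun i j k => F i j.+1 k)) -binsumD; apply: eq_binsum => i.
  by rewrite binsumS.
Qed.

Lemma lrm_sub u : {subset lrm u <= u}.
Proof.
elim: u => [|v u IH] x //=; case: ifP => _; rewrite !inE.
  by case/predU1P => [->|/IH ->]; rewrite ?eqxx ?orbT.
by move=> /IH ->; rewrite orbT.
Qed.

Lemma uniq_lrm u : uniq (lrm u).
Proof.
elim: u => [|v u IH] //=; case: ifP => //= /allP uv; rewrite IH andbT.
by apply/negP => /lrm_sub /uv; rewrite ltnn.
Qed.

Lemma lrm_nil u : (lrm u == [::]) = (u == [::]).
Proof.
elim: u => [|v u IH] //=; case: ifP => // /negbT.
by case: u IH => // w u IH _; rewrite IH.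
Qed.

(** The number [G k a b] of the recursion, read off the maxima [l]. It is 0 without [r]: undoing a
    pass adds only some [h > r] to a subset of the maxima, so [r] never comes back among them. *)
Definition lrweight (r k : nat) (l : seq nat) : int :=
  if r \in l
  then iter (count (fun x => x < r) l) fdiff (fun m => Posz (polyB m k))
         (count (fun x => r < x) l)
  else 0%R.

(** The first letter, stored last, is always the least left-to-right maximum, and [G 0 a b] requires
    that no maximum lie below [r]. *)
Lemma lrweight0 r u : u != [::] ->
  lrweight r 0 (lrm u) = Posz (last 0 u == r).
Proof.
rewrite /lrweight; elim: u => [|v u IH] // _.
have [->|u0] := eqVneq u [::].
  rewrite /= inE eq_sym; case: eqVneq => // ->.
  by rewrite iter_fdiff_polyB0 ltnn.
have -> : last 0 (v :: u) = last 0 u by case: u u0 {IH}.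
rewrite -IH //=; have [/allP uv|//] := boolP (all (fun y => y < v) u).
rewrite inE /= !iter_fdiff_polyB0; case: eqVneq => [->|rv] /=; last first.
  by case: ifP => // /lrm_sub /uv rltv; rewrite ltnNge (ltnW rltv).
rewrite ltnn add0n; case: ifP => [/lrm_sub /uv|_]; first by rewrite ltnn.
have : lrm u != [::] by rewrite lrm_nil.
case E : (lrm u) => [|y l] // _; rewrite /= (uv y) // lrm_sub // E mem_head //.
Qed.

Lemma lrweightS r k u h : r < h -> all (fun y => y < h) u ->
  lrweight r k.+1 (lrm u) =
  (lrweight r k (lrm u) + \sum_(t <- unbubbles u h) lrweight r k (lrm t.2))%R.
Proof.
move=> rh uh; have := @sum_unbubbles u h (lrweight r k) uh.
pose G a b := iter a fdiff (fun m => Posz (polyB m k)) b.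
(* The count [j] is 0 when the subset drops [r]; the new maximum [h] lies above [r], hence
   [t.+1]. *)
pose F i j t := if j is 0 then 0%R else G i t.+1.
have FE s : lrweight r k (h :: s) =
    F (count (fun x => x < r) s) (count (fun x => x == r) s) (count (fun x => r < x) s).
  rewrite /lrweight inE (ltn_eqF rh) /= rh (ltnNge h) (ltnW rh) add0n add1n.
  rewrite -has_pred1 has_count /=.
  by case: (count (pred1 r) s).
have -> : (\sum_(s <- sublists (lrm u)) lrweight r k (h :: s))%R = (\sum_(s <- sublists (lrm u))
  F (count (fun x => x < r)%N s) (count (fun x => x == r) s) (count (fun x => r < x)%N s))%R.
  by apply: eq_bigr => s _.
rewrite sum_sublists FE /lrweight.
rewrite (count_uniq_mem _ (uniq_lrm u)); case: ifP => rl /=.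
  (* Taking the full subset away gives the negative term [G k a (b + 1)] of the recursion. *)
  move=> /(canRL (addrK _)) ->; rewrite iter_fdiff_polyB_rec /G.
  rewrite [in RHS](eq_binsum _ _ (fun i => binsum (count (fun x => r < x) (lrm u))
    (fun t => G i t.+1))); first by rewrite addrA addrAC.
  by move=> i; rewrite binsumS !binsum0 [X in (X + _)%R]big1 ?add0r // => j _; rewrite mulr0.
rewrite addr0 add0r => ->; rewrite /binsum big1 // => i _.
by rewrite big_ord1 big1 ?mulr0 // => j _; rewrite mulr0.
Qed.

(** * Undoing all the passes *)

Fixpoint rlm (s : seq nat) : seq nat :=
  if s is h :: s' then
    if all (fun y => h < y) s' then h :: rlm s' else rlm s'
  else [::].

(** The head of [hs] is the chip ejected last, so it is put back first. Each result pairs the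
    inserted chips with the word before any pass. *)
Fixpoint unwind (u hs : seq nat) : seq (seq nat * seq nat) :=
  if hs is h :: hs' then
    [seq (t.1 :: s.1, s.2) | t <- preimages u h, s <- unwind t.2 hs']
  else [:: ([::], u)].

(** An ejected chip exceeds the word it leaves behind, and later passes can only lower this word,
    position by position. *)
Lemma unwind_lt u hs s : s \in unwind u hs ->
  all (fun h => all (fun y => y < h) u) hs.
Proof.
elim: hs u s => [|h hs IH] u s //= /allpairsPdep[[x w] [s' [xw /IH hw _]]] /=.
have := bubble_preimages _ _ _ _ xw; move: xw; rewrite mem_preimages => /andP[-> _] Exw /=.
by apply: sub_all hw => h' /(@bubble_lt x); rewrite Exw.
Qed.

Fixpoint settle (xs u0 : seq nat) : seq nat * seq nat :=
  if xs is x :: xs' then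
    let: (u, hs) := settle xs' u0 in
    let: (h, w) := bubble x u in (w, h :: hs)
  else (u0, [::]).

Lemma perm_settle xs u0 :
  perm_eq ((settle xs u0).1 ++ (settle xs u0).2) (xs ++ u0).
Proof.
elim: xs => [|x xs IH] /=; first by rewrite cats0.
case: (settle xs u0) IH => u hs /= IH; have := perm_bubble x u.
case: (bubble x u) => h w /= hw.
rewrite -cat1s perm_catCA /= -cat_cons (perm_trans (perm_cat hw (perm_refl hs))) //=.
by rewrite perm_cons.
Qed.

Lemma settle_unwind u hs s : s \in unwind u hs -> settle s.1 s.2 = (u, hs).
Proof.
elim: hs u s => [|h hs IH] u s /=; first by rewrite inE => /eqP ->.
case/allpairsPdep => -[x w] [s' [xw /IH sw ->]] /=.
by rewrite sw (bubble_preimages _ _ _ _ xw).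
Qed.

Lemma unwindP u hs xs u0 : uniq (xs ++ u0) ->
  ((xs, u0) \in unwind u hs) = (settle xs u0 == (u, hs)).
Proof.
move=> uniq_s; apply/idP/eqP; first by move=> /settle_unwind.
elim: xs u hs uniq_s => [|x xs IH] u hs; first by move=> _ [<- <-]; rewrite inE.
move=> uniq_xs /=; have := perm_settle xs u0.
case E : (settle xs u0) => [w hs'] /= perm_w.
case Eb : (bubble x w) => [h w'] [<- <-].
have uniq_xw : uniq (x :: w).
  move: uniq_xs; rewrite /= -(perm_uniq perm_w) -(perm_mem perm_w) cat_uniq mem_cat negb_or.
  by case/andP => /andP[-> _] /andP[].
apply/allpairsPdep; exists (x, w), (xs, u0); split => //.
  by rewrite preimagesP // Eb.
by apply: IH => //; case/andP: uniq_xs.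
Qed.

Lemma uniq_unwind u hs : uniq (u ++ hs) -> uniq (unwind u hs).
Proof.
elim: hs u => [|h hs IH] u //= uniq_uh.
have uniq_hu : uniq (h :: u ++ hs) by move: uniq_uh; rewrite -cat1s uniq_catCA.
have hu : h \notin u by move: uniq_hu; rewrite /= mem_cat negb_or => /andP[/andP[]].
have uu : uniq u by move: uniq_uh; rewrite cat_uniq => /andP[].
apply: allpairs_uniq_dep => [|t tu|]; first exact: uniq_preimages.
  apply: IH; have : uniq ((t.1 :: t.2) ++ hs).
    by rewrite (perm_uniq (perm_cat (perm_preimages _ _ _ tu) (perm_refl hs))).
  by case/andP.
move=> [t s] [t' s'] /allpairsPdep[t1 [s1 [t1u s1u E1]]].
move: E1 => [-> ->] {t s}.
move=> /allpairsPdep[t2 [s2 [t2u s2u E2]]].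
move: E2 => [-> ->] {t' s'} /= [].
move=> E0 E1 E2; have s12 : s1 = s2 by rewrite [s1]surjective_pairing E1 E2 -surjective_pairing.
have : t1.2 = t2.2.
  by have := settle_unwind _ _ _ s1u; rewrite s12 (settle_unwind _ _ _ s2u) => -[].
move=> E3; have -> : t1 = t2 by rewrite [t1]surjective_pairing E0 E3 -surjective_pairing.
by rewrite s12.
Qed.

Lemma sum_unwind r u hs : u != [::] -> uniq (u ++ hs) ->
  all (fun h => r < h) hs -> all (fun h => all (fun y => y < h) u) hs ->
  (\sum_(s <- unwind u hs) Posz (last 0 s.2 == r))%R =
  lrweight r (size (rlm hs)) (lrm u).
Proof.
elim: hs u => [|h hs IH] u u0 uniq_uh; first by rewrite big_seq1 lrweight0.
move=> /= /andP[rh rhs] /andP[uh uhs].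
have uniq_huh : uniq (h :: u ++ hs) by move: uniq_uh; rewrite -cat1s uniq_catCA.
rewrite big_allpairs_dep /= /preimages uh big_cons /=.
have uniq_uhs : uniq (u ++ hs) by case/andP: uniq_huh.
rewrite IH //.
have perm_t t : t \in unbubbles u h -> perm_eq (t.1 :: t.2 ++ hs) (h :: u ++ hs).
  by move=> /perm_unbubbles tu; apply: (perm_cat tu (perm_refl hs)).
case: ifP => [hhs|/negbT/allPn[h' h'hs hh']] /=.
  rewrite (lrweightS _ _ _ h) //; congr (_ + _)%R; apply: eq_big_seq => t tu.
  have tp := perm_unbubbles _ _ _ tu; apply: IH => //.
  - by apply: contra_neq u0 => t0; apply/nilP; move: (perm_size tp); rewrite t0 => -[] /esym/eqP.
  - by have := perm_uniq (perm_t t tu); rewrite uniq_huh => /andP[].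
  - apply/allP => h' h'hs; have : all (fun y => y < h') (t.1 :: t.2).
      by rewrite (perm_all _ tp) /= (allP hhs) ?(allP uhs).
    by case/andP.
(* A nontrivial preimage keeps [h] in its word, while [h'], still to be put back, would have to
   exceed that word. *)
rewrite [X in (_ + X)%R]big1_seq ?addr0 // => t /andP[_ tu].
rewrite big1_seq // => s /andP[_ /unwind_lt /allP /(_ h' h'hs) /allP].
by move=> /(_ h (unbubbles_mem _ _ _ tu)); rewrite (negPf hh').
Qed.

(** * Configurations as flagged words, firings as rewriting steps *)

Fixpoint placed (c : config) (k : nat) (w : seq (bool * nat)) : bool :=
  if w is a :: w' then (c a.2 == Posz (k + a.1)) && placed c k.+1 w' else true.

(* A configuration is encoded by a word of flagged chips: the chip of index [t]
   in the word sits at site [t] if its flag is [false] and at site [t + 1] if its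
   flag is [true].  Two chips then share a site exactly when they are adjacent
   with flags [true], [false]. *)
Definition encodes (N : nat) (c : config) (w : seq (bool * nat)) : Prop :=
  perm_eq (unzip2 w) (iota 1 N) /\ placed c 0 w.

Definition fire (c : config) (i : int) (alpha beta : nat) : config :=
  fun x => if x == alpha then (i - 1)%R else if x == beta then (i + 1)%R else c x.

Lemma placed_cat c k w1 w2 :
  placed c k (w1 ++ w2) = placed c k w1 && placed c (k + size w1) w2.
Proof.
elim: w1 k => [|a w1 IH] k /=; first by rewrite addn0.
by rewrite IH andbA addSnnS.
Qed.

Lemma eq_placed c c' k w :
  {in unzip2 w, c =1 c'} -> placed c k w = placed c' k w.
Proof.
elim: w k => [|a w IH] k //= cc'; rewrite cc' ?mem_head // IH // => x xw.
by apply: cc'; rewrite inE xw orbT.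
Qed.

Lemma placed_nth c k w d t : placed c k w -> t < size w ->
  c (nth d w t).2 = Posz (k + t + (nth d w t).1).
Proof.
elim: w k t => [|a w IH] k [|t] //= /andP[/eqP ca cw] tw; first by rewrite addn0.
by rewrite (IH k.+1) // addSnnS.
Qed.

(** Both chips lie at site [size z + 1]. The smaller one moves to site [size z], which is flag
    [false] at index [size z]; the larger one moves to site [size z + 2], which is flag [true] at
    the next index. *)
Lemma encodes_fire N c z x y w :
  encodes N c (z ++ (true, x) :: (false, y) :: w) ->
  let c' := fire c (Posz (size z).+1) (minn x y) (maxn x y) in
  topple_step N c c' /\
  encodes N c' (z ++ (false, minn x y) :: (true, maxn x y) :: w).
Proof.
move=> [perm_w]; rewrite placed_cat /= add0n addn1 addn0.
move=> /andP[zc /and3P[/eqP cx /eqP cy cw]]; set c' := fire _ _ _ _.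
have := perm_uniq perm_w; rewrite iota_uniq /unzip2 map_cat /= => uniq_w.
have perm_xy s : perm_eq (minn x y :: maxn x y :: s) (x :: y :: s).
  rewrite /minn /maxn; case: ifP => // _.
  by rewrite -(cat1s x) -(cat1s y) perm_catCA.
have : uniq (x :: y :: unzip2 z ++ unzip2 w).
  rewrite -[x :: y :: _]/([:: x; y] ++ _) uniq_catCA; exact: uniq_w.
rewrite /= inE negb_or !mem_cat !negb_or => /and3P[/and3P[xy xz xw] /andP[yz yw] _].
have fresh (s : seq nat) : x \notin s -> y \notin s -> {in s, c =1 c'}.
  move=> xs ys a aS; rewrite /c' /fire; case: (ltnP x y) => _;
  by rewrite !ifN //; apply: contraTneq aS => ->.
split.
  exists (Posz (size z).+1), (minn x y), (maxn x y).
  have xN a : a \in [:: x; y] -> 1 <= a <= N.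
    move=> axy; have : a \in iota 1 N.
      rewrite -(perm_mem perm_w) /unzip2 map_cat mem_cat /=.
      by move: axy; rewrite !inE => /orP[->|->]; rewrite ?orbT.
    by rewrite mem_iota add1n ltnS.
  have /andP[x1 xN'] := xN x (mem_head _ _).
  have /andP[y1 yN'] : 1 <= y <= N by apply: xN; rewrite !inE eqxx orbT.
  rewrite /c' /fire; have [lxy|lxy] : x < y \/ y < x by apply/orP; rewrite -neq_ltn.
    by rewrite (minn_idPl (ltnW lxy)) (maxn_idPr (ltnW lxy)) lxy x1.
  by rewrite (minn_idPr (ltnW lxy)) (maxn_idPl (ltnW lxy)) lxy y1.
split.
  apply: perm_trans perm_w; rewrite /unzip2 !map_cat perm_cat2l; exact: perm_xy.
rewrite placed_cat /= add0n -(eq_placed c) ?zc; last exact: fresh.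
rewrite -[placed c' _ w](eq_placed c) ?cw ?andbT; last exact: fresh.
rewrite /c' /fire eqxx addn0 addn1.
have -> : (maxn x y == minn x y) = false.
  by rewrite /minn /maxn; case: ltngtP xy => // lxy _; rewrite ?(gtn_eqF lxy) ?(ltn_eqF lxy).
rewrite eqxx; apply/andP; split; apply/eqP; lia.
Qed.

(** Index [t] reaches only the sites [t] and [t + 1], so two chips at one site are neighbours
    flagged [true], [false]. *)
Lemma topple_step_encodes N c c' w :
  encodes N c w -> topple_step N c c' ->
  exists z x y v, w = z ++ (true, x) :: (false, y) :: v /\
    c' = fire c (Posz (size z).+1) (minn x y) (maxn x y).
Proof.
move=> [perm_w cw] [i [alpha [beta [/andP[alpha1 ab] betaN ca cb ->]]]].
have key z e1 z' e2 v : w = z ++ e1 :: z' ++ e2 :: v -> c e1.2 = i -> c e2.2 = i ->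
    [/\ w = z ++ (true, e1.2) :: (false, e2.2) :: v & i = Posz (size z).+1].
  move=> Ew c1 c2; move: cw; rewrite Ew placed_cat /= placed_cat /=.
  move=> /and5P[_ /eqP + _ /eqP + _]; rewrite c1 c2 => -> [].
  case: e1 e2 {c1 c2 Ew} => [[] x] [[] y] /=; try lia.
  by case: z' => [|a z'] /=; [rewrite addn1 | lia].
have [/mapP[e1 e1w Ea] /mapP[e2 e2w Eb]] : alpha \in unzip2 w /\ beta \in unzip2 w.
  by rewrite !(perm_mem perm_w) !mem_iota add1n !ltnS; split; lia.
have e21 : e2 != e1 by apply: contraTneq ab => E; rewrite Ea Eb E ltnn.
case/splitPr: e1w key e2w => w1 w2 key; rewrite mem_cat inE (negPf e21) /= => /orP[] e2w.
  case/splitPr: e2w key => w11 w12 key.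
  have [] := key w11 e2 w12 e1 w2; rewrite -?Ea -?Eb // -?catA //.
  move=> Ew Ei; exists w11, beta, alpha, w2; split; first exact: Ew.
  by rewrite /fire -Ei (minn_idPr (ltnW ab)) (maxn_idPl (ltnW ab)).
case/splitPr: e2w key => w21 w22 key.
have [] := key w1 e1 w21 e2 w22; rewrite -?Ea -?Eb //.
move=> Ew Ei; exists w1, alpha, beta, w22; split; first exact: Ew.
by rewrite /fire -Ei (minn_idPl (ltnW ab)) (maxn_idPr (ltnW ab)).
Qed.

(** * The stable outcome as an invariant of firing *)

(** Predicts the outcome by reading letters from the right: a chip flagged [false] joins the entry
    end of the word, a chip flagged [true] makes a pass through it. *)
Fixpoint normal_form (w : seq (bool * nat)) : seq nat * seq nat :=
  if w is (b, x) :: w' then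
    let: (u, hs) := normal_form w' in
    if b then let: (h, u') := bubble x u in (u', h :: hs) else (rcons u x, hs)
  else ([::], [::]).

(** By [bubble_rcons] a firing is the first comparison of a pass; hence the outcome does not depend
    on the order of the firings. *)
Lemma normal_form_fire z x y w :
  normal_form (z ++ (false, minn x y) :: (true, maxn x y) :: w) =
  normal_form (z ++ (true, x) :: (false, y) :: w).
Proof.
elim: z => [|[b a] z IH] /=; last by rewrite IH.
by case: (normal_form w) => u hs; rewrite bubble_rcons; case: (bubble _ u).
Qed.

Lemma normal_form_lowered vs w :
  normal_form ([seq (false, x) | x <- vs] ++ w) =
  ((normal_form w).1 ++ rev vs, (normal_form w).2).
Proof.
elim: vs => [|x vs IH] /=; first by rewrite cats0; case: (normal_form w).
by rewrite IH rev_cons rcons_cat.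
Qed.

Lemma normal_form_raised xs w :
  normal_form ([seq (true, x) | x <- xs] ++ w) =
  ((settle xs (normal_form w).1).1, (settle xs (normal_form w).1).2 ++ (normal_form w).2).
Proof.
elim: xs => [|x xs IH] /=; first by case: (normal_form w).
rewrite IH; case: (settle xs _) => u hs /=.
by case: (bubble x u).
Qed.

Lemma settle_nil hs : settle hs [::] = ([::], hs).
Proof. by elim: hs => [|h hs IH] //=; rewrite IH. Qed.

Definition flag_le (a b : bool * nat) : bool := a.1 ==> b.1.

Lemma normal_form_sorted w : sorted flag_le w ->
  rev (normal_form w).1 ++ (normal_form w).2 = unzip2 w.
Proof.
have tr : transitive flag_le by move=> [[] ?] [[] ?] [[] ?].
elim: w => [|[b x] w IH] //=; rewrite (path_sortedE tr) => /andP[xw /IH {}IH].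
case: b xw => xw; last first.
  by case: (normal_form w) IH => u hs /= <-; rewrite rev_rcons.
have -> : w = [seq (true, y) | y <- unzip2 w].
  elim: w xw {IH} => [|[b y] w IHw] //= /andP[+ /IHw <-].
  by rewrite /flag_le /= => ->.
rewrite -[X in normal_form X]cats0 normal_form_raised /= settle_nil /= cats0.
by rewrite /unzip2 (mapK (f := pair true)).
Qed.

Lemma sorted_placed c k w : placed c k w ->
  sorted flag_le w -> sorted (fun x y => (c x < c y)%R) (unzip2 w).
Proof.
elim: w k => [|[b x] [|[b' y] w] IH] k // /andP[/eqP /= cx cw] /andP[bb' sw] /=.
move: (cw) => /andP[/eqP /= cy _]; rewrite cx cy; apply/andP; split; last exact: IH cw sw.
by move: bb'; rewrite /flag_le /= ltz_nat => {IH cw sw cx cy}; case: b; case: b' => //= _; lia.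
Qed.

Lemma reads_as_encodes N c w pi : encodes N c w -> reads_as N c pi ->
  pi = rev (normal_form w).1 ++ (normal_form w).2.
Proof.
move=> [perm_w cw] [perm_pi sorted_pi].
have tr : transitive (fun x y => (c x < c y)%R) by move=> y x z; apply: lt_trans.
have irr : irreflexive (fun x y => (c x < c y)%R) by move=> x; apply: ltxx.
have perm_wpi : unzip2 w =i pi by move=> x; rewrite (perm_mem perm_w) (perm_mem perm_pi).
(* A flag [true] followed by [false] would put two letters of [pi] on one site, against strict
   increase. *)
have sw : sorted flag_le w.
  apply/(sortedP (false, 0)) => t tw; rewrite /flag_le.
  have := placed_nth _ _ _ (false, 0) _ cw tw.
  have := placed_nth _ _ _ (false, 0) _ cw (ltnW tw).
  case E1 : (nth _ w t) => [[] x]; case E2 : (nth _ w t.+1) => [[] y] //=.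
  rewrite addn1 addn0 add0n => cx cy.
  have nth2 i : i < size w -> (nth (false, 0) w i).2 = nth 0 (unzip2 w) i.
    by move=> iw; rewrite (nth_map (false, 0)).
  have xy : x != y.
    have := congr1 snd E1; have := congr1 snd E2; rewrite !nth2 ?(ltnW tw) //= => <- <-.
    rewrite nth_uniq ?size_map ?(ltnW tw) ?(perm_uniq perm_w) ?iota_uniq //.
    by rewrite neq_ltn ltnSn.
  have xpi : x \in pi.
    by rewrite -perm_wpi; apply/mapP; exists (nth (false, 0) w t);
      rewrite ?E1 // -?E1 ?mem_nth // ltnW.
  have ypi : y \in pi.
    by rewrite -perm_wpi; apply/mapP; exists (nth (false, 0) w t.+1); rewrite ?E2 // -?E2 ?mem_nth.
  suff : index x pi = index y pi.
    by move=> /(congr1 (nth 0 pi)); rewrite !nth_index // => exy; rewrite exy eqxx in xy.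
  have := sorted_ltn_index tr sorted_pi.
  move=> H; case: (ltngtP (index x pi) (index y pi)) => // lt.
    by have := H _ _ xpi ypi lt; rewrite cx cy ltxx.
  by have := H _ _ ypi xpi lt; rewrite cx cy ltxx.
rewrite normal_form_sorted //; apply: (irr_sorted_eq tr irr) => //.
exact: sorted_placed cw sw.
Qed.

Lemma topples_star_trans N c1 c2 c3 :
  topples_star N c1 c2 -> topples_star N c2 c3 -> topples_star N c1 c3.
Proof. by elim=> // c c' c'' cc' _ IH /IH; apply: ts_step. Qed.

(** The chip flagged [true] fires with each chip on its right in turn, the larger one going on: this
    realises one pass. *)
Lemma topples_past_lowered N x vs c z w :
  encodes N c (z ++ (true, x) :: [seq (false, y) | y <- vs] ++ w) ->
  exists c', topples_star N c c' /\
    encodes N c' (z ++ [seq (false, y) | y <- rev (bubble x (rev vs)).2] ++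
                  (true, (bubble x (rev vs)).1) :: w).
Proof.
elim: vs x c z => [|y vs IH] x c z /=; first by exists c; split => //; apply: ts_refl.
move=> /encodes_fire; set c1 := fire _ _ _ _ => -[step].
rewrite -cat_rcons => /IH[c' [c1c' enc]]; exists c'; split; first exact: ts_step c1c'.
by rewrite rev_cons bubble_rcons /= rev_rcons /= -cat_rcons.
Qed.

Lemma topples_to_normal_form N w z c : encodes N c (z ++ w) ->
  exists c', topples_star N c c' /\
    encodes N c' (z ++ [seq (false, y) | y <- rev (normal_form w).1] ++
                  [seq (true, y) | y <- (normal_form w).2]).
Proof.
elim: w z c => [|[b x] w IH] z c /=; first by exists c; split => //; apply: ts_refl.
rewrite -cat_rcons => /IH[c1 [cc1]]; rewrite cat_rcons.
case: (normal_form w) => u hs /=; case: b; last first.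
  by move=> enc; exists c1; rewrite rev_rcons.
move=> /topples_past_lowered[c' [c1c']]; rewrite revK.
by case: (bubble x u) => h u' /= enc; exists c'; split => //; apply: topples_star_trans c1c'.
Qed.

Lemma topples_toP N c w pi : encodes N c w ->
  topples_to N c pi <-> pi = rev (normal_form w).1 ++ (normal_form w).2.
Proof.
move=> enc; split=> [[c' [cc' reads]]|->].
  elim: cc' w enc reads => {c c'} [c w|c c1 c' step _ IH w enc reads].
    exact: reads_as_encodes.
  have [z [x [y [v [Ew Ec1]]]]] := topple_step_encodes _ _ _ _ enc step.
  rewrite Ew in enc *; have [_] := encodes_fire _ _ _ _ _ _ enc.
  by rewrite -Ec1 -normal_form_fire => /IH; apply.
have [c' [cc' [perm_w' cw']]] := topples_to_normal_form _ _ [::] _ enc.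
move: perm_w' cw'; rewrite /= => perm_w' cw'; exists c'; split => //.
set w' := (_ ++ _) in perm_w' cw'.
have sw' : sorted flag_le w'.
  rewrite /w'; elim: (rev _) => [|v vs IHvs] /=.
    by elim: (_.2) => [|x [|y s] IHs].
  by rewrite path_min_sorted // all_predT.
have <- : unzip2 w' = rev (normal_form w).1 ++ (normal_form w).2.
  by rewrite /unzip2 map_cat (mapK (f := pair false)) // (mapK (f := pair true)).
by split => //; apply: sorted_placed cw' sw'.
Qed.

(** * Initial configurations and their encodings *)

Lemma normal_form_initial xs vs :
  normal_form ([seq (true, x) | x <- xs] ++ [seq (false, x) | x <- vs]) =
  settle xs (rev vs).
Proof.
by rewrite normal_form_raised -[map (pair false) vs]cats0 normal_form_lowered /= cats0;
  case: settle.
Qed.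

Lemma size_settle xs u : size (settle xs u).2 = size xs.
Proof.
elim: xs => [|x xs IH] //=; move: IH; case: (settle xs u) => w hs /= <-.
by case: (bubble x w).
Qed.

Lemma placed_flag c k (b : bool) s :
  (forall t, t < size s -> c (nth 0 s t) = Posz (k + b + t)) ->
  placed c k [seq (b, x) | x <- s].
Proof.
elim: s k => [|x s IH] k // H /=; rewrite (H 0) // addn0 eqxx.
by apply: IH => t ts; rewrite (H t.+1) // addnS.
Qed.

(** The chips [xs] of sites [1] to [p] take indices [0] to [p - 1] with flag [true], the others take
    the indices from [p] on with flag [false]; only the last chip of [xs] and [r] share a site. *)
Lemma encodes_initial n p c xs r vs : size xs = p ->
  perm_eq (xs ++ r :: vs) (iota 1 n) ->
  (forall t, t < size xs -> c (nth 0 xs t) = Posz t.+1) -> c r = Posz p ->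
  (forall t, t < size vs -> c (nth 0 vs t) = Posz (p + t).+1) ->
  encodes n c ([seq (true, x) | x <- xs] ++ [seq (false, x) | x <- r :: vs]).
Proof.
move=> xsp perm_n cxs cr cvs; split.
  by rewrite /unzip2 map_cat (mapK (f := pair true)) // (mapK (f := pair false)).
rewrite placed_cat /= size_map xsp add0n addn0 cr eqxx /=.
by rewrite !placed_flag // => t tv; rewrite cvs // addn0 addSn.
Qed.

Lemma in_S_encodes m p c : 1 <= p <= m -> in_S m p c ->
  exists xs r vs, [/\ size xs = p, perm_eq (xs ++ r :: vs) (iota 1 m.+1) &
    encodes m.+1 c ([seq (true, x) | x <- xs] ++ [seq (false, x) | x <- r :: vs])].
Proof.
move=> /andP[p1 pm] inS.
pose chips i := [seq x <- iota 1 m.+1 | c x == Posz i].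
have size_chips i : 1 <= i <= m -> size (chips i) = if i == p then 2 else 1.
  by move=> im; rewrite size_filter; have := inS (Posz i); rewrite /nchips im.
have mem_chips i t : 1 <= i <= m -> t < size (chips i) ->
    c (nth 0 (chips i) t) = Posz i /\ nth 0 (chips i) t \in iota 1 m.+1.
  by move=> im /(mem_nth 0); rewrite mem_filter => /andP[/eqP].
pose f i := nth 0 (chips i) 0.
have fP i : 1 <= i <= m -> c (f i) = Posz i /\ f i \in iota 1 m.+1.
  by move=> im; apply: mem_chips => //; rewrite size_chips //; case: ifP.
have p1m : 1 <= p <= m by rewrite p1.
pose r := nth 0 (chips p) 1.
have [cr rm] : c r = Posz p /\ r \in iota 1 m.+1.
  by apply: mem_chips; rewrite ?size_chips ?eqxx.
have rfp : r != f p.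
  by rewrite nth_uniq ?size_chips ?eqxx // filter_uniq // iota_uniq.
have iota_split : iota 1 m = iota 1 p ++ iota p.+1 (m - p).
  by rewrite -[p.+1]add1n -iotaD subnKC.
have uniq_f : uniq (map f (iota 1 m)).
  rewrite map_inj_in_uniq ?iota_uniq // => i j.
  rewrite !mem_iota !add1n !ltnS => /fP[ci _] /fP[cj _] fij.
  by move: ci; rewrite fij cj => -[].
have perm_all : perm_eq (map f (iota 1 p) ++ r :: map f (iota p.+1 (m - p))) (iota 1 m.+1).
  rewrite -(cat1s r) perm_catCA /= -map_cat -iota_split.
  have uniq_rf : uniq (r :: map f (iota 1 m)).
    rewrite /= uniq_f andbT; apply/mapP => -[i]; rewrite mem_iota add1n ltnS => im rfi.
    have [ci _] := fP _ im; move: ci; rewrite -rfi cr => -[pi].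
    by move: rfp; rewrite rfi pi eqxx.
  apply: uniq_perm (iota_uniq 1 m.+1) _; first exact: uniq_rf.
  apply: (uniq_min_size uniq_rf _ _).2; last by rewrite /= size_map !size_iota.
  move=> x; rewrite inE => /predU1P[->//|/mapP[i]].
  by rewrite mem_iota add1n ltnS => /fP[_ fm] ->.
exists (map f (iota 1 p)), r, (map f (iota p.+1 (m - p))); split => //.
  by rewrite size_map size_iota.
apply: (encodes_initial _ p) => //.
- by rewrite size_map size_iota.
- move=> t; rewrite size_map size_iota => tp.
  rewrite (nth_map 0) ?size_iota // nth_iota //.
  by apply: (fP _ _).1; lia.
- move=> t; rewrite size_map size_iota => tp.
  rewrite (nth_map 0) ?size_iota // nth_iota // addSn.
  by apply: (fP _ _).1; lia.
Qed.

Definition skip (r x : nat) : nat := if x < r then x else x.+1.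
Definition unskip (r x : nat) : nat := if x < r then x else x.-1.

Lemma skipK r : cancel (skip r) (unskip r).
Proof.
move=> x; rewrite /skip /unskip; case: (ltnP x r) => xr; first by rewrite xr.
by rewrite ltnNge ltnW.
Qed.

Lemma unskipK r x : x != r -> skip r (unskip r x) = x.
Proof.
rewrite neq_ltn /skip /unskip => /orP[xr|rx]; first by rewrite xr xr.
by rewrite (ltnNge x) (ltnW rx) /= ifN; lia.
Qed.

Lemma skip_neq r x : skip r x != r.
Proof. by rewrite /skip; case: ifP; lia. Qed.

Lemma perm_skip_iota n r : 1 <= r <= n ->
  perm_eq (r :: map (skip r) (iota 1 n.-1)) (iota 1 n).
Proof.
move=> rn; have -> : n.-1 = r.-1 + (n - r) by lia.
rewrite iotaD map_cat.
have -> : map (skip r) (iota 1 r.-1) = iota 1 r.-1.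
  rewrite -[RHS]map_id; apply/eq_in_map => x; rewrite mem_iota /skip => xr.
  by case: ifP => //; lia.
have -> : map (skip r) (iota (1 + r.-1) (n - r)) = iota r.+1 (n - r).
  rewrite -[r.+1]add1n [RHS]iotaDl; have -> : 1 + r.-1 = r by lia.
  by apply/eq_in_map => x; rewrite mem_iota /skip => xr; case: ifP => //; lia.
rewrite -(cat1s r) perm_catCA.
have E : n = r.-1 + (n - r).+1 by lia.
rewrite [X in perm_eq _ (iota 1 X)]E iotaD; have -> : 1 + r.-1 = r by lia.
exact: perm_refl.
Qed.

Lemma sigma_rp_encodes n p r sigma : 1 <= r <= n -> p <= n.-1 ->
  perm_eq sigma (iota 1 n.-1) ->
  let tau := map (skip r) sigma in
  perm_eq (take p tau ++ r :: drop p tau) (iota 1 n) /\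
  encodes n (sigma_rp sigma r p)
    ([seq (true, x) | x <- take p tau] ++ [seq (false, x) | x <- r :: drop p tau]).
Proof.
move=> rn pn perm_sigma tau.
have size_sigma : size sigma = n.-1 by rewrite (perm_size perm_sigma) size_iota.
have uniq_sigma : uniq sigma by rewrite (perm_uniq perm_sigma) iota_uniq.
have perm_tau : perm_eq (take p tau ++ r :: drop p tau) (iota 1 n).
  rewrite -(cat1s r) perm_catCA /= cat_take_drop.
  apply: perm_trans (perm_skip_iota _ _ rn); rewrite perm_cons; exact: perm_map.
have size_take_tau : size (take p tau) = p.
  by rewrite size_take_min size_map size_sigma; apply/minn_idPl.
have site t : t < n.-1 -> sigma_rp sigma r p (nth 0 tau t) = Posz t.+1.
  move=> tn; rewrite (nth_map 0) ?size_sigma // /sigma_rp (negPf (skip_neq _ _)).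
  by rewrite -/(unskip r _) skipK index_uniq ?size_sigma.
split=> //; apply: (encodes_initial _ p) => //.
- by rewrite size_take_tau => t tp; rewrite nth_take // site //; lia.
- by rewrite /sigma_rp eqxx.
- by rewrite size_drop size_map size_sigma => t tp; rewrite nth_drop site //; lia.
Qed.

(** * Agreement with the maxima and minima defined by positions *)

Lemma lrmaxima_rcons s x :
  lrmaxima (rcons s x) =
  if all (fun y => y <= x) s then rcons (lrmaxima s) x else lrmaxima s.
Proof.
rewrite /lrmaxima size_rcons -addn1 iotaD filter_cat map_cat /= add0n.
have -> : [seq j <- iota 0 (size s) | is_lrmax (rcons s x) j] =
          [seq j <- iota 0 (size s) | is_lrmax s j].
  apply: eq_in_filter => j; rewrite mem_iota add0n /= => js.
  apply: eq_in_all => i; rewrite mem_iota add0n ltnS => /= ij.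
  by rewrite !nth_rcons js (leq_ltn_trans ij js).
have -> : [seq nth 0 (rcons s x) j | j <- iota 0 (size s) & is_lrmax s j] =
          [seq nth 0 s j | j <- iota 0 (size s) & is_lrmax s j].
  apply/eq_in_map => j; rewrite mem_filter mem_iota add0n => /and3P[_ _ js].
  by rewrite nth_rcons js.
have -> : is_lrmax (rcons s x) (size s) = all (fun y => y <= x) s.
  rewrite /is_lrmax -addn1 iotaD all_cat /= add0n leqnn !andbT.
  rewrite nth_rcons ltnn eqxx -{3}[s](mkseq_nth 0) all_map.
  by apply: eq_in_all => i; rewrite mem_iota add0n => /= si; rewrite nth_rcons si.
by case: ifP => _ /=; rewrite ?cats0 // nth_rcons ltnn eqxx cats1.
Qed.

(** Distinct entries turn the weak comparisons of [lrmaxima] into the strict ones of [lrm]. *)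
Lemma lrmaxima_rev u : uniq u -> lrmaxima (rev u) = rev (lrm u).
Proof.
elim: u => [|v u IH] //= /andP[vu uu].
rewrite rev_cons lrmaxima_rcons all_rev IH //.
have -> : all (fun y => y <= v) u = all (fun y => y < v) u.
  apply: eq_in_all => y yu; rewrite leq_eqVlt; case: eqVneq => // yv.
  by rewrite -yv yu in vu.
by case: ifP => _; rewrite ?rev_cons.
Qed.

Lemma rlminima_cons x s :
  rlminima (x :: s) =
  if all (fun y => x <= y) s then x :: rlminima s else rlminima s.
Proof.
have -> : all (fun y => x <= y) s = is_rlmin (x :: s) 0.
  by rewrite /is_rlmin subn0 -[in LHS](mkseq_nth 0 s) /= leqnn (iotaDl 1 0) !all_map.
rewrite /rlminima /= (iotaDl 1 0) filter_map.
have -> : [seq j <- iota 0 (size s) | preim (addn 1) (is_rlmin (x :: s)) j] =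
          [seq j <- iota 0 (size s) | is_rlmin s j].
  apply: eq_in_filter => j _; rewrite /= /is_rlmin /= add1n subSS -add1n iotaDl all_map.
  by apply: eq_all => i.
have E : [seq nth 0 (x :: s) j | j <- [seq 1 + i | i <- [seq j <- iota 0 (size s) | is_rlmin s j]]]
  = [seq nth 0 s j | j <- iota 0 (size s) & is_rlmin s j].
  by rewrite -map_comp; apply: eq_map => j.
by case: ifP => _ /=; rewrite E.
Qed.

Lemma size_rlminima s : uniq s -> size (rlminima s) = size (rlm s).
Proof.
elim: s => [|x s IH] //= /andP[xs us]; rewrite rlminima_cons.
have -> : all (fun y => x <= y) s = all (fun y => x < y) s.
  apply: eq_in_all => y ys; rewrite leq_eqVlt; case: eqVneq => // xy.
  by rewrite xy ys in xs.
by case: ifP => _ /=; rewrite IH.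
Qed.

(** * Configurations toppling to [pi] as unwindings *)

(** Each of the [p] passes ejects one chip, so the ejected chips fill exactly the last [p] letters
    of [pi]. *)
Lemma topples_to_initial n c p xs vs pi : size xs = p -> size (xs ++ vs) = n ->
  encodes n c ([seq (true, x) | x <- xs] ++ [seq (false, x) | x <- vs]) ->
  topples_to n c pi ->
  settle xs (rev vs) = (rev (take (n - p) pi), drop (n - p) pi).
Proof.
move=> xsp size_n enc /(topples_toP _ _ _ _ enc); rewrite normal_form_initial => ->.
have := perm_size (perm_settle xs (rev vs)).
rewrite !size_cat size_settle size_rev => /eqP; rewrite xsp addnC eqn_add2l => /eqP su.
have -> : n - p = size (rev (settle xs (rev vs)).1).
  by rewrite size_rev su -size_n size_cat xsp addKn.
by rewrite take_size_cat // drop_size_cat // revK -surjective_pairing.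
Qed.

Lemma perm_cat_rev (s t : seq nat) : perm_eq (s ++ rev t) (s ++ t).
Proof. by rewrite perm_cat2l perm_rev. Qed.

(** A single configuration toppling to [pi] gives an unwinding, to which [unwind_lt] applies. The
    resulting bounds are those that [sum_unwind] requires. *)
Lemma p_resultant_lt n p pi : 1 <= p <= n - 1 -> p_resultant n p pi ->
  all (fun h => all (fun y => y < h) (rev (take (n - p) pi))) (drop (n - p) pi).
Proof.
move=> pn [c []]; case: n pn => [|m] pn; first by lia.
move=> inS; have pm : 1 <= p <= m by lia.
have [xs [r [vs [xsp perm_n enc]]]] := in_S_encodes _ _ _ pm inS.
have size_n : size (xs ++ r :: vs) = m.+1 by rewrite (perm_size perm_n) size_iota.
move=> /(topples_to_initial _ _ _ _ _ _ xsp size_n enc) /eqP.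
rewrite -unwindP; first exact: unwind_lt.
by rewrite (perm_uniq (perm_cat_rev _ _)) (perm_uniq perm_n) iota_uniq.
Qed.

Theorem theorem2p14 (n p r : nat) (pi : seq nat) :
  (2 <= n) -> (1 <= p <= n - 1) -> (1 <= r <= n - p) ->
  perm_eq pi (iota 1 n) ->
  p_resultant n p pi ->
  r \in lrmaxima (take (n - p) pi) ->
  forall a b k : nat,
    a = count (fun x => x < r) (lrmaxima (take (n - p) pi)) ->
    b = count (fun x => r < x) (lrmaxima (take (n - p) pi)) ->
    k = size (rlminima (drop (n - p) pi)) ->
  (* L enumerates (without repetition) the sigma in S_{n-1} with
     sigma^(r,p) toppling to pi, so size L = N_pi *)
  forall L : seq (seq nat),
    uniq L ->
    (forall sigma, sigma \in L <->
        (perm_eq sigma (iota 1 n.-1) /\ topples_to n (sigma_rp sigma r p) pi)) ->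
    (Posz (size L) = iter a fdiff (fun m => Posz (polyB m k)) b /\
     Posz (size L) = (\sum_(t < a.+1)
        (-1) ^+ (a - t) * Posz 'C(a, t) * Posz (polyB (b + t) k))%R).
Proof.
move=> n2 pn rn perm_pi res rL a b k -> -> -> L uniq_L LP.
set u := rev (take (n - p) pi); set hs := drop (n - p) pi.
have uniq_pi : uniq pi by rewrite (perm_uniq perm_pi) iota_uniq.
have size_pi : size pi = n by rewrite (perm_size perm_pi) size_iota.
have perm_uhs : perm_eq (u ++ hs) pi.
  by rewrite -[pi in X in perm_eq _ X](cat_take_drop (n - p)) perm_cat2r perm_rev.
have uniq_uhs : uniq (u ++ hs) by rewrite (perm_uniq perm_uhs).
have /and3P[uu _ uhs] : [&& uniq u, ~~ has (mem u) hs & uniq hs] by rewrite -cat_uniq.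
have lrE : lrmaxima (take (n - p) pi) = rev (lrm u).
  by rewrite -[take _ _]revK lrmaxima_rev.
have lt_uhs := p_resultant_lt _ _ _ pn res.
have ru : r \in lrm u by rewrite -mem_rev -lrE.
have size_u : size u = n - p by rewrite size_rev size_takel // size_pi; lia.
have size_hs : size hs = p by rewrite size_drop size_pi; lia.
have rn' : 1 <= r <= n by lia.
have pn' : p <= n.-1 by lia.
have u0 : u != [::] by rewrite -size_eq0 size_u; lia.
have size_L : Posz (size L) = lrweight r (size (rlm hs)) (lrm u).
  rewrite -sum_unwind //; last first.
    by apply/allP => h /(allP lt_uhs) /allP; apply; apply: lrm_sub.
  transitivity (Posz (count (fun s => last 0 s.2 == r) (unwind u hs))); last first.
    rewrite -sum1_count big_mkcond /= (big_morph Posz PoszD (erefl _)).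
    by apply: eq_bigr => s _; case: eqP.
  rewrite -size_filter; congr Posz.
  (* [psi] pairs the chips of sites [1] to [p] with the reversed initial word, whose last entry is
     [r]; it is shown to map [L] bijectively onto the unwindings ending in [r]. *)
  pose psi sigma := let tau := map (skip r) sigma in (take p tau, rev (r :: drop p tau)).
  rewrite -(size_map psi); apply/perm_size/uniq_perm.
  - rewrite map_inj_uniq // => s s' [E1 /(can_inj revK)[E2]].
    apply: (inj_map (can_inj (skipK r))).
    by rewrite -[LHS](cat_take_drop p) E1 E2 cat_take_drop.
  - exact/filter_uniq/uniq_unwind.
  move=> [xs v]; rewrite mem_filter /=; apply/mapP/andP.
    move=> [sigma /LP[perm_sigma tops] [-> ->]].
    have [perm_tau enc] := sigma_rp_encodes _ _ _ _ rn' pn' perm_sigma.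
    rewrite rev_cons last_rcons eqxx -rev_cons; split=> //.
    have uniq_tau := perm_uniq perm_tau; rewrite iota_uniq in uniq_tau.
    rewrite unwindP; last first.
      by rewrite (perm_uniq (perm_cat_rev _ _)).
    apply/eqP; apply: topples_to_initial tops => //.
      by rewrite size_takel // size_map (perm_size perm_sigma) size_iota.
    by rewrite (perm_size perm_tau) size_iota.
  (* Conversely, [r] is taken off the end of [v] and [unskip r] relabels the remaining chips into
     [sigma]. *)
  move=> [/eqP lastv mem_s]; have settle_s := settle_unwind _ _ _ mem_s.
  have := perm_settle xs v; rewrite settle_s /= => perm_s.
  have size_xs : size xs = p by rewrite -(size_settle xs v) settle_s.
  have size_v : size v = n - p.
    by have := perm_size perm_s; rewrite !size_cat size_u size_hs size_xs addnC => /addnI.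
  have [ws Ev] : exists ws, v = rev (r :: ws).
    case/lastP: v lastv size_v {mem_s settle_s perm_s} => [|v x]; first by rewrite /=; lia.
    by rewrite last_rcons => -> _; exists (rev v); rewrite rev_cons revK.
  have perm_n : perm_eq (r :: xs ++ ws) (iota 1 n).
    rewrite -(permPr (perm_trans perm_uhs perm_pi)) (permPr perm_s) Ev.
    rewrite (permPr (perm_cat_rev _ _)) -(cat1s r ws) perm_sym perm_catCA.
    exact: perm_refl.
  have rxw : r \notin xs ++ ws.
    by have := perm_uniq perm_n; rewrite iota_uniq => /andP[].
  have tauE : map (skip r) (map (unskip r) (xs ++ ws)) = xs ++ ws.
    rewrite -map_comp -[RHS]map_id; apply/eq_in_map => x xin /=.
    by rewrite unskipK //; apply: contraNneq rxw => <-.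
  have perm_sigma : perm_eq (map (unskip r) (xs ++ ws)) (iota 1 n.-1).
    rewrite -(mapK (skipK r) (iota 1 n.-1)); apply: perm_map.
    by rewrite -(perm_cons r) (perm_trans perm_n) // perm_sym perm_skip_iota.
  exists (map (unskip r) (xs ++ ws)); last first.
    by rewrite /psi tauE take_size_cat // drop_size_cat // -Ev.
  apply/LP; split=> //.
  have [_ enc] := sigma_rp_encodes _ _ _ _ rn' pn' perm_sigma.
  apply/(topples_toP _ _ _ _ enc).
  rewrite tauE take_size_cat // drop_size_cat // normal_form_initial -Ev settle_s /=.
  by rewrite revK cat_take_drop.
have E : Posz (size L) = iter (count (fun x => x < r) (lrmaxima (take (n - p) pi))) fdiff
    (fun m => Posz (polyB m (size (rlminima hs))))
    (count (fun x => r < x) (lrmaxima (take (n - p) pi))).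
  by rewrite size_L /lrweight ru lrE !count_rev size_rlminima.
by rewrite E; split=> //; rewrite iter_fdiff_sum.
Qed.
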